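(* For every $2$-degenerate graph $G$ we have $\bar\theta(G)\le \bar{\mathsf a}(G)\le 4$, where $\bar\theta(G)$ denotes the geometric thickness and $\bar{\mathsf a}(G)$ the geometric arboricity of $G$.
   Context: Graphs are finite and simple. A graph is $2$-degenerate if every subgraph (with at least one vertex) contains a vertex of degree at most $2$ in that subgraph. A geometric drawing of a graph places the vertices at distinct points of the plane and draws each edge as the straight-line segment between its endpoints, such that no edge contains a vertex in its interior. Two edges cross if they share a point that is interior to both; a crossing in an edge-colored drawing is monochromatic if the two crossing edges have the same color. The geometric thickness $\bar\theta(G)$ is the smallest number of colors for which there is a geometric drawing of $G$ together with an edge coloring with that many colors and with no monochromatic crossing. The geometric arboricity $\bar{\mathsf a}(G)$ is the smallest number of colors for which there is a geometric drawing of $G$ together with an edge coloring with that many colors, with no monochromatic crossing, and such that every color class is acyclic (a forest). *)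

(* Defs.v *)
(* Finite graphs are MathComp finTypes; the plane is R^2 over a realType. *)
From HB Require Import structures.
From mathcomp Require Import all_boot all_order all_algebra.
From mathcomp Require Import boolp reals.
From mathcomp Require Import ring.

Set Implicit Arguments.
Unset Strict Implicit.
Unset Printing Implicit Defensive.

Import Order.TTheory GRing.Theory Num.Theory.
Local Open Scope ring_scope.

Record sgraph := SGraph {
  vertex :> finType;
  adj : rel vertex;
  adj_sym : symmetric adj;
  adj_irr : irreflexive adj }.

Definition edge_set (G : sgraph) : {set {set G}} :=
  [set [set x; y] | x in G, y in G & adj x y].

(* [f] is the adjacency relation of a subgraph of [G] with vertex set [S]; the
   subgraph need not be induced. *)
Definition subgraph (G : sgraph) (S : {set G}) (f : rel G) : Prop :=
  symmetric f /\ forall x y, f x y -> [/\ x \in S, y \in S & adj x y].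

Definition degenerate (d : nat) (G : sgraph) : Prop :=
  forall (S : {set G}) (f : rel G), subgraph S f -> S != set0 ->
    exists2 x, x \in S & (#|[set y in S | f x y]| <= d)%N.

(* Closed walks of length at most 2 are not cycles: [ucycle f] holds for the
   sequence [:: x; y] as soon as x and y are distinct and adjacent. *)
Definition acyclic (T : finType) (f : rel T) : Prop :=
  forall s : seq T, ucycle f s -> (size s <= 2)%N.

Definition color_class (G : sgraph) (c : {set G} -> nat) (i : nat) : rel G :=
  fun x y => adj x y && (c [set x; y] == i).

Section Drawings.
Variable R : realType.

Definition segment_interior (a b p : 'rV[R]_2) : Prop :=
  exists t : R, 0 < t < 1 /\ p = (1 - t) *: a + t *: b.

Definition geometric_drawing (G : sgraph) (pos : G -> 'rV[R]_2) : Prop :=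
  injective pos /\
  forall x y z : G, adj x y -> ~ segment_interior (pos x) (pos y) (pos z).

Definition cross (G : sgraph) (pos : G -> 'rV[R]_2) (x y u v : G) : Prop :=
  [set x; y] != [set u; v] /\
  exists p, segment_interior (pos x) (pos y) p /\
            segment_interior (pos u) (pos v) p.

(* The values of the coloring [c] on two-element sets other than edges, and on
   sets of other cardinalities, are irrelevant; the codomain is [nat] rather
   than ['I_k] so that edgeless graphs admit a coloring with no color. *)
Definition proper_drawing (G : sgraph) (k : nat)
    (pos : G -> 'rV[R]_2) (c : {set G} -> nat) : Prop :=
  [/\ geometric_drawing pos,
      forall A, A \in edge_set G -> (c A < k)%N
    & forall x y u v : G, adj x y -> adj u v -> cross pos x y u v ->
        c [set x; y] <> c [set u; v]].

Definition thickness_drawable (G : sgraph) (k : nat) : Prop :=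
  exists pos c, @proper_drawing G k pos c.

Definition arboricity_drawable (G : sgraph) (k : nat) : Prop :=
  exists pos c, @proper_drawing G k pos c /\
    forall i, acyclic (color_class c i).

(* Vertices on a parabola, all edges of different colors. *)
Lemma arboricity_drawable_exists (G : sgraph) :
  exists k, `[< arboricity_drawable G k >].
Proof.
exists #|{set G}|; apply/asboolP.
pose h (x : G) : R := (enum_rank x)%:R.
have h_inj : injective h.
  by move=> x y /eqP; rewrite eqr_nat => /eqP/ord_inj/enum_rank_inj.
pose pos (x : G) : 'rV[R]_2 := \row_j (h x ^+ j.+1).
have posE x j : pos x 0 j = h x ^+ j.+1 by rewrite mxE.
pose c (A : {set G}) : nat := enum_rank A.
have c_inj : injective c by move=> A B /ord_inj/enum_rank_inj.
exists pos, c; split; first split.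
- split=> [x y /rowP/(_ 0)|x y z xy [t [/andP[t0 t1] /rowP pz]]].
    by rewrite !posE !expr1 => /h_inj.
  have := pz 0; have := pz 1; rewrite !mxE /= => p1 p0.
  have : t * (1 - t) * (h x - h y) ^+ 2 = 0.
    have -> : t * (1 - t) * (h x - h y) ^+ 2 =
      ((1 - t) * h x ^+ 2 + t * h y ^+ 2) - ((1 - t) * h x + t * h y) ^+ 2.
      by ring.
    move: p0 p1; rewrite !expr1 => <- <-; exact: subrr.
  move/eqP; rewrite mulf_eq0 sqrf_eq0 mulf_eq0 (gt_eqF t0) subr_eq0 (gt_eqF t1).
  by rewrite subr_eq0 => /eqP/h_inj exy; rewrite exy adj_irr in xy.
- by move=> A _; exact: ltn_ord.
- by move=> x y u v _ _ [ne _] /c_inj exy; rewrite exy eqxx in ne.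
move=> i [|x [|y [|z s]]] //= /andP[/= /and3P[/andP[_ /eqP cxy] /andP[_ /eqP cyz] _]].
rewrite !inE !negb_or => /andP[/and3P[_ xz _] /andP[/andP[yz _] _]].
have /setP/(_ z) := c_inj _ _ (etrans cxy (esym cyz)).
by rewrite !inE eqxx orbT (eq_sym z x) (eq_sym z y) (negbTE xz) (negbTE yz).
Qed.

Lemma thickness_drawable_exists (G : sgraph) :
  exists k, `[< thickness_drawable G k >].
Proof.
have [k /asboolP[pos [c [d _]]]] := arboricity_drawable_exists G.
by exists k; apply/asboolP; exists pos, c.
Qed.

Definition geometric_thickness (G : sgraph) : nat :=
  ex_minn (thickness_drawable_exists G).

Definition geometric_arboricity (G : sgraph) : nat :=
  ex_minn (arboricity_drawable_exists G).

End Drawings.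

(* Main.v *)
Require Import Defs.
From mathcomp Require Import all_boot all_order all_algebra boolp reals.
From mathcomp Require Import filter num_normedtype.
From mathcomp Require Import ring lra.

(** Order the vertices so that each has at most two earlier neighbors, the
    older one [a] and the newer one [b].  The order can be chosen breadth-first:
    a later vertex never has an earlier newer neighbor ([breadth_first]).  Give
    every vertex a side, opposite to the side of its newer neighbor; the side
    names the coordinate (horizontal or vertical) that is the main one for this
    vertex, and the other coordinate is its lateral one.

    Vertices are placed one at a time ([placement]).  A vertex v gets a main
    coordinate far beyond everything drawn so far, and a lateral coordinate
    slightly larger than that of its older neighbor.  So, when the main
    direction is upwards, v lies high up almost exactly above its older
    neighbor, and the edge to its newer neighbor leaves that neighbor almost
    vertically too, if seen from the scale of the old drawing.  The color of an
    edge records the side of its later endpoint v and whether the other endpoint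
    is the older or the newer neighbor of v: four colors.

    Within a color every vertex has at most one earlier neighbor, so that a
    monochromatic cycle is impossible: look at its latest vertex
    ([color_class_acyclic]).  For crossings consider two edges of one color,
    with upwards as main direction.

    - Edges to older neighbors ([old_edges_disjoint]).  The vertical ray that
      starts at a vertex never meets an earlier edge of this color: such an
      edge spans a tiny lateral interval above its lower end, all vertices that
      later enter this interval are themselves placed high up, above the line
      of the edge, and the new edge follows the ray.

    - Edges to newer neighbors ([new_edges_disjoint]).  The newer neighbor b of
      v has the opposite side, so that it is to the right of everything before
      it, and the edge goes from b to the left.  It passes above all old
      vertices to the left of b ([below_new_edge]).  By the breadth-first order
      an earlier edge of the same color starts at b or to the left of b, and it
      goes to the left as well, so it stays below the new edge. *)

Set Implicit Arguments.
Unset Strict Implicit.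
Unset Printing Implicit Defensive.

Import Order.TTheory GRing.Theory Num.Theory.

(** * Breadth-first degeneracy orders *)

Definition earlier (G : sgraph) (r : G -> nat) (x : G) : {set G} :=
  [set y | adj x y & (r y < r x)%N].

(** A vertex of small degree is put last, and the rest is ordered by
    induction. *)
Lemma degenerate_order (d : nat) (G : sgraph) :
  degenerate d G ->
  exists2 r : G -> nat, injective r & forall x, (#|earlier r x| <= d)%N.
Proof.
move=> degG.
suff order_set n (S : {set G}) : #|S| = n ->
    exists2 r : G -> nat, {in S &, injective r}
      & {in S, forall x, (#|earlier r x :&: S| <= d)%N}.
  have [r r_inj r_deg] := order_set _ [set: G] erefl.
  exists r => [x y|x]; first by apply: r_inj; rewrite inE.
  by rewrite -[earlier r x]setIT r_deg ?inE.
elim: n S => [|n IHn] S cardS.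
  move/eqP: cardS; rewrite cards_eq0 => /eqP->.
  by exists (fun=> 0%N) => x; rewrite inE.
have S_neq0 : S != set0 by rewrite -card_gt0 cardS.
pose f := [rel x y | [&& x \in S, y \in S & adj (s := G) x y]].
have [|x xS x_deg] := degG S f _ S_neq0.
  split=> [x y|x y /and3P[]//]; rewrite /f /= adj_sym.
  by case: (x \in S); case: (y \in S).
have [|r r_inj r_deg] := IHn (S :\ x).
  by move: (cardsD1 x S); rewrite xS cardS => -[].
pose m := (\max_(y in S :\ x) r y).+1.
have lt_m y : y \in S -> y != x -> (r y < m)%N.
  by move=> yS yx; rewrite ltnS; apply: leq_bigmax_cond; rewrite !inE yx.
exists (fun y => if y == x then m else r y).
  move=> y z yS zS; case: eqVneq => [->|yx]; case: eqVneq => [->|zx] //.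
  - by move=> e; have := lt_m _ zS zx; rewrite e ltnn.
  - by move=> e; have := lt_m _ yS yx; rewrite e ltnn.
  - by apply: r_inj; rewrite !inE ?yx ?zx.
move=> y yS; have [->|yx] := eqVneq y x.
  apply: leq_trans x_deg; apply/subset_leq_card/subsetP => z.
  by rewrite !inE /= xS => /andP[/andP[-> _] ->].
apply: leq_trans (r_deg y _); last by rewrite !inE yx.
apply/subset_leq_card/subsetP => z; rewrite !inE (negbTE yx).
case: (eqVneq z x) => [->|zx] /andP[/andP[-> lt_zy] ->]; last by rewrite lt_zy.
by have := ltn_trans lt_zy (lt_m _ yS yx); rewrite ltnn.
Qed.

Section Breadth.
Variables (T : finType) (par : rel T) (r : T -> nat).
Hypothesis par_r : forall y x, par y x -> (r y < r x)%N.

(** One more than the time of the latest parent, and 0 without parents.  Its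
    monotonicity in time is the breadth-first property, as it needs no notion
    of depth. *)
Definition key (t : T -> nat) (x : T) : nat := \max_(y | par y x) (t y).+1.

(** Greedy: among the elements all of whose parents are already listed, append
    one whose key is smallest.  An element that becomes available by this step
    has the new last element as a parent, hence the largest possible key; so no
    later choice can have a smaller key than an earlier one. *)
Lemma breadth_first : exists t : T -> nat,
  [/\ injective t, forall y x, par y x -> (t y < t x)%N
    & forall x y, (t x <= t y)%N -> (key t x <= key t y)%N].
Proof.
pose good (s : seq T) (t : T -> nat) :=
  [/\ uniq s,
      forall x y, x \in s -> par y x -> (t y < t x)%N,
      forall x y, x \in s -> y \in s -> (t x <= t y)%N -> (key t x <= key t y)%N
    & forall x y, x \in s -> (forall z, par z y -> z \in s) -> y \notin s ->
        (key t x <= key t y)%N].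
suff grow n : (n <= #|T|)%N -> exists2 s, size s = n & good s (index^~ s).
  have [s size_s [s_uniq s_par s_key _]] := grow _ (leqnn _).
  have s_all x : x \in s.
    have [] := @uniq_min_size _ s (enum T) s_uniq.
    - by move=> y _; rewrite mem_enum.
    - by rewrite -cardE size_s.
    by move=> _ ->; rewrite mem_enum.
  exists (index^~ s); split=> [x y e|y x|x y].
  - by rewrite -(nth_index x (s_all x)) e nth_index.
  - exact: s_par.
  - exact: s_key.
elim: n => [|n IHn] lt_n; first by exists [::].
have [s size_s [s_uniq s_par s_key s_next]] := IHn (ltnW lt_n).
set t := index^~ s in s_par s_key s_next.
pose avail x := (x \notin s) && [forall z, par z x ==> (z \in s)].
(* An unlisted element that comes first in the order r is available. *)
have [x0 x0_avail] : exists x, avail x.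
  have [x1 x1s] : exists x, x \notin s.
    apply/existsP; apply: contraTT lt_n; rewrite negb_exists -leqNgt -size_s.
    move=> /forallP all_s; rewrite cardE uniq_leq_size ?enum_uniq // => x _.
    by have := all_s x; rewrite negbK.
  case: (@arg_minnP _ x1 [pred x | x \notin s] r x1s) => x /= xs x_min; exists x.
  rewrite /avail xs; apply/forallP => z; apply/implyP => /par_r lt_zx.
  by apply: contraTT lt_zx => zs; rewrite -leqNgt x_min.
case: (arg_minnP (key t) x0_avail) => x /andP[xs /forallP x_par] x_min.
pose t' := index^~ (rcons s x).
have t'E y : y \in s -> t' y = t y by rewrite /t' -cats1 index_cat => ->.
have t'x : t' x = size s.
  by rewrite /t' -cats1 index_cat (negbTE xs) /= eqxx addn0.
have t_lt y : y \in s -> (t y < size s)%N by rewrite index_mem.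
have keyE y : (forall z, par z y -> z \in s) -> key t' y = key t y.
  by move=> ys; apply: eq_bigr => z /ys zs; rewrite t'E.
have par_s y z : y \in s -> par z y -> z \in s.
  by move=> ys zy; rewrite -index_mem (ltn_trans (s_par _ _ ys zy)) ?index_mem.
have par_x z : par z x -> z \in s by apply/implyP/x_par.
have key_x y : y \in s -> (key t y <= key t x)%N by move=> ys; apply: s_next.
exists (rcons s x); first by rewrite size_rcons size_s.
rewrite -/t'; split.
- by rewrite rcons_uniq xs.
- move=> y z; rewrite mem_rcons inE => /predU1P[-> /par_x zs|ys zy].
    by rewrite t'x t'E ?t_lt.
  by rewrite !t'E //; [apply: s_par | apply: par_s zy].
- move=> y z; rewrite !mem_rcons !inE => /predU1P[->|ys] /predU1P[->|zs] //.
  + by rewrite t'x t'E // leqNgt t_lt.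
  + by rewrite (keyE x) // keyE ?key_x // => w; apply: par_s.
  + by rewrite !t'E // !keyE => [|w|w]; [apply: s_key | apply: par_s..].
move=> y z; rewrite mem_rcons inE => ys z_par.
rewrite mem_rcons inE negb_or => /andP[zx zs].
have key_y : (key t' y <= key t' x)%N.
  case/predU1P: ys => [->//|ys].
  by rewrite (keyE x) // keyE ?key_x // => w; apply: par_s.
apply: leq_trans key_y _; rewrite keyE //.
(* Either z has just become available, or it competed with x already. *)
have [xz|xz] := boolP (par x z).
  apply: (@leq_trans (size s).+1); last first.
    by rewrite /key (bigD1 x) //= t'x leq_maxl.
  by apply/bigmax_leqP => w /par_x ws; rewrite ltnW // ltnS t_lt.
have z_par' w : par w z -> w \in s.
  move=> wz; have := z_par _ wz; rewrite mem_rcons inE => /predU1P[wx|//].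
  by rewrite -wx wz in xz.
rewrite keyE //; apply: x_min; rewrite /avail zs.
by apply/forallP => w; apply/implyP/z_par'.
Qed.
End Breadth.

(** * Schedules *)

(** Functions defined by recursion on time, when the value at v is only known to
    exist, and may depend on all previous values. *)
Lemma recursive_choice (T : finType) (X : Type) (x0 : X) (t : T -> nat)
    (P : (T -> X) -> T -> Prop) :
  injective t ->
  (forall f g v, (forall u, (t u <= t v)%N -> f u = g u) -> P f v -> P g v) ->
  (forall f v, (forall u, (t u < t v)%N -> P f u) ->
     exists x, P (fun u => if u == v then x else f u) v) ->
  exists f, forall v, P f v.
Proof.
move=> t_inj P_loc P_step.
have [f Pf] : exists f, forall v, (t v < (\max_v t v).+1)%N -> P f v.
  elim: (\max_v t v).+1 => [|n [f Pf]]; first by exists (fun=> x0).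
  have [v /eqP tv|no_v] := pickP (fun v => t v == n); last first.
    by exists f => v; rewrite ltnS leq_eqVlt no_v; apply: Pf.
  have [u|x Px] := P_step f v; first by rewrite tv; apply: Pf.
  exists (fun u => if u == v then x else f u) => u.
  rewrite ltnS leq_eqVlt -{1}tv => /orP[/eqP/t_inj->//|lt_un].
  apply: P_loc (Pf u lt_un) => w le_wu; case: eqVneq => // wv.
  by move: (leq_ltn_trans le_wu lt_un); rewrite wv tv ltnn.
by exists f => v; apply: Pf; rewrite ltnS leq_bigmax.
Qed.

(** The combinatorial data that the drawing is built from.  The equality
    [new x = x] stands for the absence of earlier neighbors, and
    [old x = new x <> x] for a single one. *)
Record schedule (G : sgraph) := Schedule {
  time : G -> nat;
  old : G -> G;
  new : G -> G;
  side : G -> bool;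
  time_inj : injective time;
  earlierP : forall x y, adj x y -> (time y < time x)%N ->
    new x != x /\ (y = old x \/ y = new x);
  old_new : forall x, (time (old x) <= time (new x) <= time x)%N;
  new_mono : forall x y, new x != x -> new y != y ->
    (time x <= time y)%N -> (time (new x) <= time (new y))%N;
  side_new : forall x, new x != x -> side x = ~~ side (new x) }.

Lemma degenerate2_schedule (G : sgraph) :
  degenerate 2 G -> inhabited (schedule G).
Proof.
move=> /degenerate_order[r r_inj r_deg].
pose par := [rel y x | adj (s := G) x y && (r y < r x)%N].
have [|t [t_inj t_par t_key]] := @breadth_first _ par r; first by move=> y x /andP[].
have parE x y : (y \in earlier r x) = par y x by rewrite inE.
have /fin_all_exists[ab abP] x : exists ab : G * G,
    [/\ forall y, par y x -> ab.2 != x /\ (y = ab.1 \/ y = ab.2),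
        (t ab.1 <= t ab.2 <= t x)%N & ab.2 != x -> key par t x = (t ab.2).+1].
  have [N0|[y0 y0N]] := set_0Vmem (earlier r x).
    exists (x, x); split; rewrite ?leqnn ?eqxx //= => y.
    by rewrite -[adj _ _ && _]/(par y x) -parE N0 inE.
  case: (arg_maxnP t y0N) => b bN b_max.
  have b_max' y : y \in earlier r x -> (t y <= t b)%N by move/b_max.
  have [a aN abN] : exists2 a, a \in earlier r x
      & forall y, y \in earlier r x -> y = a \/ y = b.
    have [N1|[a]] := set_0Vmem (earlier r x :\ b).
      exists b => // y yN; have : y \notin earlier r x :\ b by rewrite N1 inE.
      by rewrite in_setD1 yN andbT negbK => /eqP; right.
    rewrite in_setD1 => /andP[ab aN]; exists a => // y yN.
    have [|yb] := eqVneq y b; first by right.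
    have [|ya] := eqVneq y a; first by left.
    have : [set y; a; b] \subset earlier r x.
      by rewrite !subUset !sub1set yN aN.
    move/subset_leq_card; rewrite -setUA cardsU1 !inE negb_or ya yb /= cards2 ab.
    by move/leq_trans/(_ (r_deg x)).
  have b_par : par b x by rewrite -parE.
  exists (a, b); split=> /=.
  - move=> y; rewrite -[_ && _]/(par y x) -parE => /abN; split=> //.
    by apply: contraTneq (t_par _ _ b_par) => ->; rewrite ltnn.
  - by apply/andP; split; [exact: b_max' | exact/ltnW/t_par].
  - move=> _; apply/eqP; rewrite eqn_leq /key; apply/andP; split.
      by apply/bigmax_leqP => y y_par; rewrite ltnS b_max' // parE.
    by rewrite (bigD1 b) //= leq_maxl.
(* With a newer neighbor the key is one more than its time, so the monotone
   key makes [new] monotone. *)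
pose a x := (ab x).1; pose b x := (ab x).2.
have [f g v fg fv bv|f v _|s sP] := @recursive_choice _ bool true t
    (fun s x => b x != x -> s x = ~~ s (b x)) t_inj.
- by rewrite -!fg ?fv //; case: (abP v) => _ /andP[].
- by exists (~~ f (b v)) => /negbTE bv; rewrite eqxx bv.
have key_b x : b x != x -> key par t x = (t (b x)).+1.
  by case: (abP x) => _ _; apply.
constructor; unshelve eapply (@Schedule G t a b s t_inj _ _ _ sP).
- move=> x y xy lt_yx; case: (abP x) => ab_par _ _; apply: ab_par => /=.
  rewrite xy /= ltnNge; apply: contraL lt_yx => le_xy.
  rewrite -leqNgt ltnW // t_par //= adj_sym xy ltn_neqAle le_xy andbT.
  by apply: contraTneq xy => /r_inj->; rewrite adj_irr.
- by move=> x; case: (abP x).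
- by move=> x y /key_b bx /key_b bY /t_key; rewrite bx bY ltnS.
Qed.

Section ScheduleTheory.
Variables (G : sgraph) (S : schedule G).
Local Notation t := (time S).
Local Notation a := (old S).
Local Notation b := (new S).

Lemma new_le x : (t (b x) <= t x)%N.
Proof. by case/andP: (old_new S x). Qed.

Lemma new_lt x : b x != x -> (t (b x) < t x)%N.
Proof.
by rewrite ltn_neqAle new_le andbT; apply: contra_neq => /(@time_inj _ S).
Qed.

Lemma old_lt x : b x != x -> (t (a x) < t x)%N.
Proof. by case/andP: (old_new S x) => + _ /new_lt; apply: leq_ltn_trans. Qed.

Lemma old_lt_new x : a x != b x -> (t (a x) < t (b x))%N.
Proof.
case/andP: (old_new S x) => + _; rewrite ltn_neqAle => -> /=; rewrite andbT.
by apply: contra_neq => /(@time_inj _ S).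
Qed.

Lemma lt_neq x y : (t x < t y)%N -> (x == y) = false.
Proof. by apply: contraTF => /eqP->; rewrite ltnn. Qed.

End ScheduleTheory.

(** * Placing the vertices *)

Local Open Scope ring_scope.

Section Placement.
Variables (R : realType) (G : sgraph) (S : schedule G).
Local Notation t := (time S).
Local Notation a := (old S).
Local Notation b := (new S).
Local Notation side := (side S).

(** Points are functions from [bool] to the coordinates, so that the arguments
    for the two sides are literally the same.  If q is taken as the abscissa,
    [turn q c w u] is the orientation determinant of c, w and u: if c is to the
    left of w, it is positive exactly when u is above the line through c and
    w. *)
Definition turn (q : bool) (c w u : bool -> R) : R :=
  (w q - c q) * (u (~~ q) - c (~~ q)) - (w (~~ q) - c (~~ q)) * (u q - c q).

(** What the position of v has to satisfy relative to all earlier vertices.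
    With the main coordinate of v vertical: v is above all of them; a vertex
    without earlier neighbors is also to the right of all of them; any other v is to
    the right of its older neighbor with no earlier vertex in the gap, it is
    above the lines of the earlier edges to older neighbors, and the line to its
    newer neighbor b passes above the earlier vertices to the left of b. *)
Definition placed (p : G -> bool -> R) (v : G) : Prop :=
  let q := ~~ side v in
  [/\ forall u, (t u < t v)%N -> p u (~~ q) < p v (~~ q),
      b v = v -> forall u, (t u < t v)%N -> p u q < p v q
    & b v != v ->
      [/\ p (a v) q < p v q,
          forall u, (t u < t v)%N -> p u q <= p (a v) q \/ p v q < p u q,
          forall w, b w != w -> side w = side v -> (t w < t v)%N ->
            0 < turn q (p (a w)) (p w) (p v)
        & forall u, (t u < t v)%N -> p u q < p (b v) q ->
            turn q (p v) (p (b v)) (p u) < 0]].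

Lemma placed_local (p p' : G -> bool -> R) v :
  (forall u, (t u <= t v)%N -> p u = p' u) -> placed p v -> placed p' v.
Proof.
move=> pp' [p1 pr p2].
have pv : p v = p' v by apply: pp'.
have pu u : (t u < t v)%N -> p u = p' u by move/ltnW/pp'.
split; rewrite -pv.
- by move=> u uv; rewrite -pu //; apply: p1.
- by move=> bv u uv; rewrite -pu //; apply: pr.
move=> bv.
have [av_lt uP wP cP] := p2 bv; rewrite -!pu ?old_lt ?new_lt //.
split=> // [u uv|w bw sw wv|u uv]; rewrite -!pu //; first exact: uP.
- exact: wP.
- exact: ltn_trans (old_lt bw) wv.
- exact: cP.
Qed.

(** The two orientation conditions of [placed] have this form for the position
    with main coordinate Y and lateral offset 1 / Y. *)
Lemma near_affine (al be ga : R) : 0 < al ->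
  \forall Y \near +oo, be + ga / Y < al * Y.
Proof.
move=> al0; near=> Y.
have Y1 : 1 < Y by near: Y; apply: nbhs_pinfty_gt.
have : (`|be| + `|ga|) / al < Y by near: Y; apply: nbhs_pinfty_gt; apply: num_real.
rewrite ltr_pdivrMr // mulrC; apply: le_lt_trans.
rewrite lerD ?ler_norm // (le_trans (ler_norm _)) // normrM normfV.
rewrite ler_piMr // invf_le1 ?normr_gt0 ?gt_eqF ?(lt_trans _ Y1) //.
by rewrite ltW // (lt_le_trans Y1) // ler_norm.
Unshelve. all: by end_near. Qed.

(** All conditions hold once the main coordinate Y is large, with lateral offset
    1 / Y: the offset tends to 0, and both determinants are affine in Y, up to a
    vanishing term, with a slope of the right sign. *)
Lemma placement : exists p, forall v, placed p v.
Proof.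
apply: (recursive_choice (fun=> 0) (@time_inj _ S) placed_local) => f v f_placed.
set q := ~~ side v.
have f_old w : b w != w -> (t w < t v)%N -> side w = side v ->
    f (a w) q < f w q.
  by move=> bw /f_placed[_ _ /(_ bw)[]]; rewrite /q => + _ _ _ <-.
have old_neq u : (t u < t v)%N -> (u == v) = false by apply: lt_neq.
pose x (Y : R) i := if i == q then f (a v) q + Y^-1 else Y.
have xq Y : x Y q = f (a v) q + Y^-1 by rewrite /x eqxx.
have xNq Y : x Y (~~ q) = Y by rewrite /x; case: (q).
have gt_all : \forall Y \near +oo, forall u i, f u i < Y.
  apply: filter_forall => u; apply: filter_forall => i.
  by apply: nbhs_pinfty_gt; apply: num_real.
have [bv|bv] := eqVneq (b v) v.
  have [Y ltY] := filter_ex gt_all; exists (fun _ : bool => Y).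
  by rewrite /placed eqxx bv eqxx; split=> // [u|_ u] uv; rewrite old_neq.
have gap : \forall Y \near +oo, forall u, f (a v) q < f u q -> x Y q < f u q.
  apply: filter_forall => u; have [_|lt_au] := leP (f u q); first by near=> Y.
  near=> Y => _; rewrite xq.
  have : 1 + 0 / Y < (f u q - f (a v) q) * Y.
    by near: Y; apply: near_affine; rewrite subr_gt0.
  rewrite mul0r addr0 -ltr_pdivrMr; last by near: Y; apply: nbhs_pinfty_gt.
  by rewrite mul1r ltrBrDl.
have above : \forall Y \near +oo, forall w, b w != w -> (t w < t v)%N ->
    side w = side v -> 0 < turn q (f (a w)) (f w) (x Y).
  apply: filter_forall => w.
  case: (boolP [&& b w != w, (t w < t v)%N & side w == side v]); last first.
    move=> w_no; near=> Y => bw wv /eqP sw.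
    by rewrite bw wv sw in w_no.
  move=> /and3P[bw wv /eqP sw]; near=> Y => _ _ _; rewrite -subr_gt0 /turn xq xNq.
  set c := f (a w); set d := f w.
  have : (d q - c q) * c (~~ q) + (d (~~ q) - c (~~ q)) * (f (a v) q - c q)
      + (d (~~ q) - c (~~ q)) / Y < (d q - c q) * Y.
    by near: Y; apply: near_affine; rewrite subr_gt0 f_old.
  lra.
have below : \forall Y \near +oo, forall u, f u q < f (b v) q ->
    turn q (x Y) (f (b v)) (f u) < 0.
  apply: filter_forall => u; have [_|lt_ub] := leP (f (b v) q); first by near=> Y.
  near=> Y => _; rewrite /turn xq xNq.
  set c := f (a v); set d := f (b v); set e := f u.
  have : (d q - c q) * e (~~ q) - d (~~ q) * (e q - c q)
      + (d (~~ q) - e (~~ q)) / Y < (d q - e q) * Y.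
    by near: Y; apply: near_affine; rewrite subr_gt0.
  lra.
have pos : \forall Y \near +oo, 0 < Y :> R by apply: nbhs_pinfty_gt.
have [Y [[ltY Y0] [gapY [aboveY belowY]]]] :=
  filter_ex (filterI (filterI gt_all pos) (filterI gap (filterI above below))).
exists (x Y); rewrite /placed eqxx !old_neq ?old_lt ?new_lt // -/q.
split=> [u uv|bv'|_]; first by rewrite old_neq // xNq.
  by rewrite bv' eqxx in bv.
split=> [|u uv|w bw sw wv|u uv]; rewrite ?old_neq //.
- by rewrite xq ltrDl invr_gt0.
- by case: (leP (f u q) (f (a v) q)); [left | right; apply: gapY].
- exact: aboveY.
- exact: ltn_trans (old_lt bw) wv.
- exact: belowY.
Unshelve. all: by end_near. Qed.

End Placement.

(** * Disjointness of edges of the same kind *)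

(** [segment_interior] in coordinates. *)
Definition inside (R : realType) (x y z : bool -> R) : Prop :=
  exists s : R, 0 < s < 1 /\ forall i, z i = (1 - s) * x i + s * y i.

Section Inside.
Variable R : realType.
Implicit Types (x y z c w : bool -> R).

Lemma inside_sym x y z : inside x y z -> inside y x z.
Proof.
by move=> [s [/andP[s0 s1] zE]]; exists (1 - s); split=> [|i]; rewrite ?zE; lra.
Qed.

Lemma inside_turn q c w x y z : inside x y z ->
  exists2 s, 0 < s < 1 & turn q c w z = (1 - s) * turn q c w x + s * turn q c w y.
Proof. by move=> [s [s01 zE]]; exists s => //; rewrite /turn !zE; ring. Qed.

Lemma inside_turn_gt0 q c w x y z : inside x y z ->
  0 <= turn q c w x -> 0 < turn q c w y -> 0 < turn q c w z.
Proof. by move=> /(inside_turn q c w)[s /andP[s0 s1] ->] *; nra. Qed.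

Lemma inside_turn_lt0 q c w x y z : inside x y z ->
  turn q c w x <= 0 -> turn q c w y < 0 -> turn q c w z < 0.
Proof. by move=> /(inside_turn q c w)[s /andP[s0 s1] ->] *; nra. Qed.

Lemma turn_start q c w : turn q c w c = 0.
Proof. by rewrite /turn; ring. Qed.

Lemma turn_end q c w : turn q c w w = 0.
Proof. by rewrite /turn; ring. Qed.

Lemma inside_line q c w z : inside c w z -> turn q c w z = 0.
Proof.
move=> /(inside_turn q c w)[s _ ->].
by rewrite turn_start turn_end !mulr0 addr0.
Qed.

Lemma inside_lt x y z i : inside x y z -> x i < y i -> x i < z i < y i.
Proof. by move=> [s [/andP[s0 s1] ->]] xy; apply/andP; split; nra. Qed.

End Inside.

Section Drawing.
Variables (R : realType) (G : sgraph) (S : schedule G) (p : G -> bool -> R).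
Hypothesis p_placed : forall v, placed S p v.
Local Notation t := (time S).
Local Notation a := (old S).
Local Notation b := (new S).
Local Notation side := (side S).

Lemma main_lt u v : (t u < t v)%N -> p u (side v) < p v (side v).
Proof. by case: (p_placed v) => + _ _; rewrite negbK; apply. Qed.

Lemma lateral_old v : b v != v -> p (a v) (~~ side v) < p v (~~ side v).
Proof. by case: (p_placed v) => _ _ /[apply] -[]. Qed.

Lemma lateral_gap u v : b v != v -> (t u < t v)%N ->
  p u (~~ side v) <= p (a v) (~~ side v) \/ p v (~~ side v) < p u (~~ side v).
Proof. by case: (p_placed v) => _ _ /[apply] -[_ + _ _]; apply. Qed.

Lemma old_edge_below w v : b w != w -> b v != v -> side w = side v ->
  (t w < t v)%N -> 0 < turn (~~ side v) (p (a w)) (p w) (p v).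
Proof. by move=> bw; case: (p_placed v) => _ _ /[apply] -[_ _ + _]; apply. Qed.

Lemma below_new_edge u v : b v != v -> (t u < t v)%N ->
  p u (~~ side v) < p (b v) (~~ side v) ->
  turn (~~ side v) (p v) (p (b v)) (p u) < 0.
Proof. by case: (p_placed v) => _ _ /[apply] -[_ _ _]; apply. Qed.

(** New coordinates are either larger than all earlier ones or in a gap. *)
Lemma coord_inj i : injective (p^~ i).
Proof.
suff neq u v : (t u < t v)%N -> p u i != p v i.
  move=> u v /= /eqP; case: (ltngtP (t u) (t v)) => [/neq/negbTE->//| |].
    by move=> /neq; rewrite eq_sym => /negbTE->.
  by move=> /(@time_inj _ S).
move=> uv; have [->|i_side] := eqVneq i (side v); first by rewrite lt_eqF ?main_lt.
have {i_side}-> : i = ~~ side v by case: i i_side; case: side.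
have [bv|bv] := eqVneq (b v) v.
  by rewrite lt_eqF //; case: (p_placed v) => _ /(_ bv u uv).
case: (lateral_gap bv uv) => [le_ua|lt_vu]; last by rewrite gt_eqF.
by rewrite lt_eqF // (le_lt_trans le_ua) ?lateral_old.
Qed.

(** The newer neighbor has the opposite side, so its large coordinate is the
    lateral one of v. *)
Lemma lateral_new v : b v != v -> a v != b v ->
  p v (~~ side v) < p (b v) (~~ side v).
Proof.
move=> bv /old_lt_new/main_lt.
have -> : side (b v) = ~~ side v by rewrite (side_new bv) negbK.
by case: (lateral_gap bv (new_lt bv)) => // /le_lt_trans/[apply]; rewrite ltxx.
Qed.

(** The ray that leaves u in the main direction of w does not meet the edge from
    w to its older neighbor: u is on one side of it, or above its line.  Earlier
    vertices avoid the gap between the endpoints; later ones are placed beyond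
    w in one of the two coordinates, and above the line of the edge if this is
    the main one. *)
Lemma old_edge_avoids_rays w u : b w != w -> u != a w ->
  [\/ p u (~~ side w) < p (a w) (~~ side w),
      p w (~~ side w) <= p u (~~ side w)
    | 0 < turn (~~ side w) (p (a w)) (p w) (p u)].
Proof.
move=> bw uaw; case: (ltngtP (t u) (t w)) => [uw|wu|/(@time_inj _ S)->].
- case: (lateral_gap bw uw) => [|/ltW]; last by constructor 2.
  rewrite le_eqVlt => /predU1P[/coord_inj e|]; last by constructor 1.
  by rewrite e eqxx in uaw.
- have [bu|bu] := eqVneq (b u) u.
    constructor 2; apply/ltW; case: (p_placed u) => + /(_ bu w wu).
    by rewrite negbK => /(_ w wu); case: (side u); case: (side w).
  have [su|su] := eqVneq (side u) (side w); last first.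
    constructor 2; apply/ltW; move: (main_lt wu).
    by have -> : side u = ~~ side w by case: (side u) su; case: (side w).
  by constructor 3; rewrite -su old_edge_below.
- by constructor 2.
Qed.

(** The later edge leaves its lower end, which can be only where
    [old_edge_avoids_rays] allows it, and ends above the line of the earlier
    edge. *)
Lemma old_edges_disjoint w v z : b w != w -> b v != v -> side w = side v ->
  (t w < t v)%N -> inside (p (a w)) (p w) z -> ~ inside (p (a v)) (p v) z.
Proof.
move=> bw bv sw wv zw zv; set q := ~~ side v.
have line := inside_line q zw.
have above : 0 < turn q (p (a w)) (p w) (p v) by apply: old_edge_below.
have zw_lt : p (a w) q < z q < p w q.
  by apply: inside_lt => //; rewrite /q -sw lateral_old.
have zv_lt : p (a v) q < z q < p v q by apply: inside_lt => //; apply: lateral_old.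
have ne : ~~ (0 <= turn q (p (a w)) (p w) (p (a v))).
  by apply/negP => /(inside_turn_gt0 zv)/(_ above); rewrite line ltxx.
have [e|aw_av] := eqVneq (a v) (a w); first by rewrite e turn_start lexx in ne.
case: (old_edge_avoids_rays bw aw_av); rewrite sw -/q.
- case: (lateral_gap bv (ltn_trans (old_lt bw) wv)); rewrite -/q; lra.
- lra.
- by move=> /ltW le0; rewrite le0 in ne.
Qed.

(** Breadth-first order enters here: the newer neighbor of w is that of v, or
    comes before it and hence to its left.  So both ends of the earlier edge are
    below the line of the later one, except for a common end. *)
Lemma new_edges_disjoint w v z : b w != w -> a w != b w -> b v != v ->
  side w = side v -> (t w < t v)%N ->
  inside (p (b w)) (p w) z -> ~ inside (p (b v)) (p v) z.
Proof.
move=> bw abw bv sw wv zw /inside_sym zv; set q := ~~ side v.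
have line := inside_line q zv.
have lt_wb : p w q < p (b w) q by rewrite /q -sw lateral_new.
have le_bb : p (b w) q <= p (b v) q.
  have := new_mono bw bv (ltnW wv); rewrite leq_eqVlt => /orP[/eqP/(@time_inj _ S)->//|].
  by move/main_lt => /ltW; rewrite -[side (b v)]negbK -side_new.
suff : turn q (p v) (p (b v)) z < 0 by rewrite line ltxx.
apply: (inside_turn_lt0 zw); last by apply: below_new_edge => //; apply: lt_le_trans le_bb.
move: le_bb; rewrite le_eqVlt => /predU1P[/coord_inj->|lt_bb].
  by rewrite turn_end.
by apply/ltW/below_new_edge => //; apply: ltn_trans wv; apply: new_lt.
Qed.

Lemma old_edge_no_vertex w u : b w != w -> ~ inside (p (a w)) (p w) (p u).
Proof.
move=> bw inu; set q := ~~ side w.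
have := inside_lt inu (lateral_old bw); rewrite -/q => u_lt.
have [ua|/(old_edge_avoids_rays bw)[]] := eqVneq u (a w); rewrite -?/q.
- by move: u_lt; rewrite ua ltxx.
- lra.
- lra.
- by rewrite (inside_line _ inu) ltxx.
Qed.

(** Earlier vertices are to the right of the edge or below it, and later ones are
    beyond it in one of the two coordinates. *)
Lemma new_edge_no_vertex w u : b w != w -> a w != b w ->
  ~ inside (p (b w)) (p w) (p u).
Proof.
move=> bw abw /inside_sym inu; set q := ~~ side w.
have := inside_lt inu (lateral_new bw abw); rewrite -/q => u_lt.
have [uw|wu|e] := ltngtP (t u) (t w).
- have [|lt_ub] := leP (p (b w) q) (p u q); first by lra.
  by have := below_new_edge bw uw lt_ub; rewrite (inside_line _ inu) ltxx.
- have bu := ltn_trans (new_lt bw) wu.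
  have [su|su] := eqVneq (side u) q; first by have := main_lt bu; rewrite su; lra.
  have {}su : side u = side w by move: su; rewrite /q; case: (side u); case: (side w).
  have := inside_lt (inside_sym inu) (main_lt (new_lt bw)).
  by have := main_lt wu; rewrite su; lra.
- by move: u_lt; rewrite (@time_inj _ S _ _ e) ltxx.
Qed.

End Drawing.

(** * Coloring and drawing *)

Section Coloring.
Variables (G : sgraph) (S : schedule G).
Local Notation t := (time S).
Local Notation a := (old S).
Local Notation b := (new S).
Local Notation side := (side S).

(** The color of the edge uv if u comes before v. *)
Definition edge_color (u v : G) : nat := (side v).*2 + (u != a v).

Definition coloring (A : {set G}) : nat :=
  if [pick e : G * G | (A == [set e.1; e.2]) && (t e.1 < t e.2)%N] is Some e
  then edge_color e.1 e.2 else 0%N.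

Lemma coloringE u v : (t u < t v)%N -> coloring [set u; v] = edge_color u v.
Proof.
move=> uv; rewrite /coloring; case: pickP => [[x y] /= /andP[/eqP e xy]|/(_ (u, v))].
  have /set2P xE : x \in [set u; v] by rewrite e set21.
  have /set2P yE : y \in [set u; v] by rewrite e set22.
  case: xE yE xy => -> [] -> //; rewrite ?ltnn // => vu.
  by have := ltn_trans uv vu; rewrite ltnn.
by rewrite /= eqxx uv.
Qed.

Lemma edge_color_lt4 u v : (edge_color u v < 4)%N.
Proof. by rewrite /edge_color; case: (side v); case: (u != a v). Qed.

Lemma edge_color_inj u v x y : edge_color u v = edge_color x y ->
  side v = side y /\ (u == a v) = (x == a y).
Proof.
by rewrite /edge_color; case: (side v); case: (side y); case: (u == a v);
  case: (x == a y).
Qed.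

(** In a color class every vertex has at most one earlier neighbor. *)
Lemma earlier_color u u' v : adj u v -> adj u' v -> (t u < t v)%N ->
  (t u' < t v)%N -> edge_color u v = edge_color u' v -> u = u'.
Proof.
rewrite ![adj _ v]adj_sym => uv u'v lt_uv lt_u'v /edge_color_inj[_].
case: (earlierP uv lt_uv) => _ [] ->; case: (earlierP u'v lt_u'v) => _ [] -> //.
  by rewrite eqxx => /esym/eqP->.
by rewrite eqxx => /eqP->.
Qed.

(** The two neighbors, on a cycle, of its latest vertex would be distinct
    earlier neighbors. *)
Lemma color_class_acyclic i : acyclic (color_class coloring i).
Proof.
move=> s; rewrite leqNgt => s_cycle; apply/negP => s_size.
have [v vs v_max] : exists2 v, v \in s & forall u, u \in s -> (t u <= t v)%N.
  case: s {s_cycle} s_size => [//|x s] _.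
  have xs : x \in x :: s by rewrite mem_head.
  case: (@arg_maxnP _ x (mem (x :: s)) t xs) => v vs v_max.
  by exists v => // u /v_max.
(* Rotate the cycle so that its latest vertex v comes first. *)
have [j s' s_rot] := rot_to vs.
have {s_cycle} : ucycle (color_class coloring i) (v :: s').
  by rewrite -s_rot rot_ucycle.
have {s_size} : (2 < size (v :: s'))%N by rewrite -s_rot size_rot.
have {}v_max u : u \in s' -> (t u <= t v)%N.
  by move=> us; apply: v_max; rewrite -(mem_rot j) s_rot inE us orbT.
case: s' v_max {s_rot} => [//|x s'] v_max s_size /andP[].
rewrite /cycle rcons_path [path _ _ _]/= => /andP[/andP[vx _] yv] /= /and3P[v_s x_s _].
set y := last v (x :: s') in yv.
have y_s : y \in x :: s' by rewrite /y /= mem_last.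
have lt_v u : u \in x :: s' -> (t u < t v)%N.
  move=> us; rewrite ltn_neqAle v_max // andbT.
  by apply: contraNneq v_s => /(@time_inj _ S) <-.
have xy : x = y.
  move: vx yv => /andP[vx /eqP cvx] /andP[yv /eqP cyv].
  rewrite adj_sym in vx; rewrite setUC in cvx.
  apply: (earlier_color vx yv); rewrite ?lt_v ?mem_head //.
  by rewrite -!coloringE ?lt_v ?mem_head // cvx cyv.
case: s' x_s {v_s y_s lt_v v_max vx yv} @y s_size xy => [//|z s'] x_s y _ xy.
by rewrite xy /y /= mem_last in x_s.
Qed.

End Coloring.

Section Embedding.
Variables (R : realType) (G : sgraph) (S : schedule G) (p : G -> bool -> R).
Hypothesis p_placed : forall v, placed S p v.
Local Notation t := (time S).
Local Notation a := (old S).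
Local Notation b := (new S).

Definition position (v : G) : 'rV[R]_2 := \row_j p v (j == 1).

Lemma position_interior u v (z : 'rV[R]_2) :
  segment_interior (position u) (position v) z ->
  inside (p u) (p v) (fun i => z 0 (if i then 1 else 0)).
Proof.
move=> [s [s01 ->]]; exists s; split=> // i.
by rewrite !mxE; case: i.
Qed.

Lemma position_coord v i : position v 0 (if i then 1 else 0) = p v i.
Proof. by rewrite mxE; case: i. Qed.

Lemma segment_sym (x y z : 'rV[R]_2) :
  segment_interior x y z -> segment_interior y x z.
Proof.
move=> [s [/andP[s0 s1] ->]]; exists (1 - s); split; first by lra.
by rewrite subKr addrC.
Qed.

Lemma edge_cases u v : adj u v -> (t u < t v)%N ->
  b v != v /\ ((u == a v) /\ u = a v \/ (u == a v) = false /\ u = b v /\ a v != b v).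
Proof.
rewrite adj_sym => vu uv; have [bv uE] := earlierP vu uv; split=> //.
have [|ua] := eqVneq u (a v); first by left.
by right; case: uE ua => ->; rewrite ?eqxx // eq_sym.
Qed.

Lemma edge_no_vertex x y u : adj x y -> (t x < t y)%N ->
  ~ inside (p x) (p y) (p u).
Proof.
move=> adj_xy /(edge_cases adj_xy)[by_ [[_ ->]|[_ [-> ab]]]].
  exact: old_edge_no_vertex.
exact: new_edge_no_vertex.
Qed.

Lemma same_color_disjoint x y u v z : adj x y -> adj u v ->
  (t x < t y)%N -> (t u < t v)%N -> (t y < t v)%N ->
  edge_color S x y = edge_color S u v ->
  inside (p x) (p y) z -> ~ inside (p u) (p v) z.
Proof.
move=> xy uv lt_xy lt_uv lt_yv /edge_color_inj[syv].
have [by_ xE] := edge_cases xy lt_xy; have [bv uE] := edge_cases uv lt_uv.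
case: xE => [[-> ->]|[-> [-> ab]]]; case: uE => [[-> ->]|[-> [-> abv]]] // _.
  exact: old_edges_disjoint.
exact: new_edges_disjoint.
Qed.

Lemma adj_lt u v : adj u v -> (t u < t v)%N \/ (t v < t u)%N.
Proof.
case: (ltngtP (t u) (t v)); [by left | by right |].
by move/(@time_inj _ S) ->; rewrite adj_irr.
Qed.

Lemma position_drawing : geometric_drawing position.
Proof.
split=> [u v uv|x y u].
  apply: (coord_inj p_placed (i := true)).
  by rewrite /= -!(position_coord _ true) uv.
wlog xy : x y / (t x < t y)%N => [wlog_xy adj_xy|].
  have [xy|yx] := adj_lt adj_xy; first exact: wlog_xy.
  by move/segment_sym; apply: wlog_xy => //; rewrite adj_sym.
move=> adj_xy /position_interior [s [s01 uE]].
apply: (edge_no_vertex (u := u) adj_xy xy).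
by exists s; split=> // i; rewrite -uE position_coord.
Qed.

Lemma no_monochromatic_crossing x y u v : adj x y -> adj u v ->
  cross position x y u v ->
  coloring S [set x; y] <> coloring S [set u; v].
Proof.
wlog xy : x y / (t x < t y)%N => [wlog_xy adj_xy adj_uv [ne [z [zx zu]]]|].
  have [xy|yx] := adj_lt adj_xy; first by apply: wlog_xy => //; split=> //; exists z.
  rewrite setUC; apply: wlog_xy; rewrite // 1?adj_sym //; split; first by rewrite setUC.
  by exists z; split=> //; apply: segment_sym.
wlog uv : u v / (t u < t v)%N => [wlog_uv adj_xy adj_uv [ne [z [zx zu]]]|].
  have [uv|vu] := adj_lt adj_uv; first by apply: wlog_uv => //; split=> //; exists z.
  rewrite [[set u; v]]setUC; apply: wlog_uv; rewrite // 1?adj_sym //.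
  split; first by rewrite [[set v; u]]setUC.
  by exists z; split=> //; apply: segment_sym.
move=> adj_xy adj_uv [ne [z [/position_interior zx /position_interior zu]]].
rewrite !coloringE // => e.
case: (ltngtP (t y) (t v)) => [yv|vy|/(@time_inj _ S) eyv].
- exact: same_color_disjoint zx zu.
- exact: same_color_disjoint (esym e) zu zx.
- rewrite eyv in ne adj_xy xy e.
  by rewrite (earlier_color adj_xy adj_uv xy uv e) eqxx in ne.
Qed.

End Embedding.

Lemma degenerate2_drawable (R : realType) (G : sgraph) :
  degenerate 2 G -> arboricity_drawable R G 4.
Proof.
move=> /degenerate2_schedule[S]; have [p p_placed] := placement R S.
exists (position p), (coloring S); split; last exact: color_class_acyclic.
split; first exact: position_drawing p_placed.
  move=> A /imset2P[x y _]; rewrite inE => /andP[_ xy ->].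
  have [lt_xy|lt_yx] := adj_lt S xy; last rewrite setUC.
    by rewrite coloringE ?edge_color_lt4.
  by rewrite coloringE ?edge_color_lt4.
exact: no_monochromatic_crossing p_placed.
Qed.

Theorem theorem1 (R : realType) (G : sgraph) :
  degenerate 2 G ->
  (geometric_thickness R G <= geometric_arboricity R G)%N /\
  (geometric_arboricity R G <= 4)%N.
Proof.
move=> degG; rewrite /geometric_thickness /geometric_arboricity.
case: ex_minnP => k _ k_min; case: ex_minnP => m /asboolP m_drawable m_min.
split; last exact/m_min/asboolP/degenerate2_drawable.
by apply/k_min/asboolP; case: m_drawable => pos [c [pos_c _]]; exists pos, c.
Qed.
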